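(* Let $\{P_n\}_{n\ge0}$ be a sequence of monic type II multiple polynomials, $2$-orthogonal with respect to a system of functionals $\{u^1,u^2\}$, i.e. satisfying the four-term recurrence relation $$xP_{n+2}(x)=P_{n+3}(x)+\beta_{n+2}P_{n+2}(x)+\gamma_{n+2}^1P_{n+1}(x)+\gamma_{n+1}^0P_n(x),\qquad n\ge0,$$ with $\beta_{n+2},\gamma_{n+2}^1,\gamma_{n+1}^0\in\mathbb{C}$, $\gamma_{n+1}^0\ne0$, $P_0(x)=1$, $P_1(x)=x-\beta_0$, $P_2(x)=(x-\beta_1)P_1(x)-\gamma_1^1P_0(x)$. Let $\{W_n\}_{n\ge0}$ be the $3\times3$ matrix polynomials associated with $\{P_n\}$ by $$\begin{bmatrix}P_{3n}(x) \\ P_{3n+1}(x) \\ P_{3n+2}(x)\end{bmatrix}=W_n(x^3)\begin{bmatrix}1 \\ x \\ x^2\end{bmatrix}.$$ Then the matrix polynomials $W_n$ satisfy a matrix four-term recurrence relation with matrix coefficients, i.e. there are constant complex $3\times3$ matrices $A_n,B_n,C_n,D_n$ such that, with $W_{-1}=W_{-2}=0_{3\times3}$, $$xW_n(x)=A_nW_{n+1}(x)+B_nW_n(x)+C_nW_{n-1}(x)+D_nW_{n-2}(x),\qquad n\ge0.$$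
   Context: Polynomials have complex coefficients. A $3\times3$ matrix polynomial is a $3\times 3$ matrix whose entries are polynomials; $W_n$ is uniquely determined by the displayed decomposition (sort the monomials of each $P_m$ by exponent modulo $3$). *)

(* Defs.v *)
From HB Require Import structures.
From mathcomp Require Import all_boot all_order all_algebra.
From mathcomp Require Import reals complex ring.

Set Implicit Arguments.
Unset Strict Implicit.
Unset Printing Implicit Defensive.

Import GRing.Theory.
Local Open Scope ring_scope.
Local Open Scope complex_scope.

Definition monic_sequence (C : fieldType) (P : nat -> {poly C}) : Prop :=
  forall n, P n \is monic /\ size (P n) = n.+1.

(* d-orthogonality for d = 2: for r = 1, 2, u^r (x^m P_n) vanishes when
   n >= 2 m + r and is nonzero when n = 2 m + r - 1.  Equivalently, P_n is
   type II for the step-line multi-index (ceil(n/2), floor(n/2)), with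
   regularity. *)
Definition two_orthogonal (C : fieldType) (u1 u2 : {scalar {poly C}})
    (P : nat -> {poly C}) : Prop :=
  forall m : nat,
    [/\ forall n : nat, (2 * m + 1 <= n)%N -> u1 ('X^m * P n) = 0,
        u1 ('X^m * P (2 * m)%N) != 0,
        forall n : nat, (2 * m + 2 <= n)%N -> u2 ('X^m * P n) = 0
      & u2 ('X^m * P (2 * m + 1)%N) != 0].

(* beta n, gamma1 n, gamma0 n are beta_n, gamma^1_n, gamma^0_n; the values
   gamma1 0 and gamma0 0 are never used. *)
Definition four_term_recurrence (C : fieldType) (P : nat -> {poly C})
    (beta gamma1 gamma0 : nat -> C) : Prop :=
  [/\ P 0%N = 1,
      P 1%N = 'X - (beta 0%N)%:P,
      P 2%N = ('X - (beta 1%N)%:P) * P 1%N - gamma1 1%N *: P 0%N,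
      forall n : nat, gamma0 n.+1 != 0
    & forall n : nat,
        'X * P n.+2 = P n.+3 + beta n.+2 *: P n.+2
                      + gamma1 n.+2 *: P n.+1 + gamma0 n.+1 *: P n].

(* W (x^3), entrywise. *)
Definition mx_at_cube (C : fieldType) (W : 'M[{poly C}]_3) : 'M[{poly C}]_3 :=
  map_mx (fun p : {poly C} => p \Po 'X^3) W.

Definition cubic_decomposition (C : fieldType) (P : nat -> {poly C})
    (W : nat -> 'M[{poly C}]_3) : Prop :=
  forall n : nat,
    \col_(i < 3) P (3 * n + i)%N = mx_at_cube (W n) *m \col_(i < 3) 'X^i.

(* Extension of a sequence to negative indices by the convention W_k = 0. *)
Definition zero_ext (V : nmodType) (W : nat -> V) (k : int) : V :=
  match k with Posz n => W n | Negz _ => 0 end.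

Section FavardFunctionals.
Variables (C : fieldType) (P : nat -> {poly C}) (beta gamma1 gamma0 : nat -> C).

(* Multiplication by x in coordinates with respect to P. *)
Let T (f : nat -> C) (k : nat) : C :=
  (if k is j.+1 then f j else 0) + beta k * f k + gamma1 k.+1 * f k.+1
  + gamma0 k.+1 * f k.+2.

Let a (n : nat) : nat -> C := iter n T (fun k => (k == 0%N)%:R).

Definition coord_functional (k : nat) (p : {poly C}) : C :=
  \sum_(i < size p) p`_i * a i k.

Let coordE k N (p : {poly C}) : (size p <= N)%N ->
  coord_functional k p = \sum_(i < N) p`_i * a i k.
Proof.
move=> hN; rewrite /coord_functional (big_ord_widen N (fun i => p`_i * a i k)) //.
rewrite big_mkcond /=; apply: eq_bigr => i _; case: ltnP => // hi.
by rewrite nth_default ?mul0r.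
Qed.

Fact coord_functional_is_scalar k : scalar (coord_functional k).
Proof.
move=> c p q; set N := maxn (size p) (size q).
have hp : (size p <= N)%N by rewrite leq_maxl.
have hq : (size q <= N)%N by rewrite leq_maxr.
have hs : (size (c *: p + q)%R <= N)%N.
  rewrite (leq_trans (size_polyD _ _)) // geq_max hq andbT.
  exact: leq_trans (size_scale_leq _ _) hp.
rewrite (coordE k hp) (coordE k hq) (coordE k hs) mulr_sumr -big_split /=.
by apply: eq_bigr => i _; rewrite coefD coefZ; ring.
Qed.

HB.instance Definition _ k :=
  GRing.isLinear.Build C {poly C} C _ (coord_functional k)
    (coord_functional_is_scalar k).

Let coordX p k : coord_functional k ('X * p) = T (coord_functional^~ p) k.
Proof.
have hs : (size ('X * p)%R <= (size p).+1)%N.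
  by rewrite (leq_trans (size_polyMleq _ _)) // size_polyX.
rewrite (coordE k hs) big_ord_recl coefXM /= mul0r add0r /T.
rewrite (_ : (if k is j.+1 then coord_functional j p else 0) =
  \sum_(i < size p) p`_i * (if k is j.+1 then a i j else 0)); last first.
  by case: k {hs} => // ; rewrite big1 // => i _; rewrite mulr0.
rewrite /coord_functional !mulr_sumr -!big_split /=.
apply: eq_bigr => i _; rewrite coefXM; transitivity (p`_i * T (a i) k) => //.
by rewrite /T; case: k {hs} => [|j]; move: (a i) => f; ring.
Qed.

Let T_ext f g : f =1 g -> T f =1 T g.
Proof. by move=> h k; rewrite /T !h; case: k => // k; rewrite h. Qed.

Hypothesis rec : four_term_recurrence P beta gamma1 gamma0.

Let coordP n k : coord_functional k (P n) = (k == n)%:R.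
Proof.
have [h0 h1 h2 _ h3] := rec.
have E0 j : coord_functional j (P 0%N) = (j == 0%N)%:R.
  by rewrite h0 /coord_functional size_poly1 big_ord1 coef1 mul1r.
have TE j m : T (coord_functional^~ (P m)) j =
    coord_functional j ('X * P m) by rewrite coordX.
have E1 j : coord_functional j (P 1%N) = (j == 1%N)%:R.
  have -> : P 1%N = 'X * P 0%N - beta 0%N *: P 0%N.
    by rewrite h1 h0 mulr1 alg_polyC.
  rewrite linearB linearZ /= coordX (T_ext E0) E0 /T.
  by case: j => [|[|j]] /=; ring.
have E2 j : coord_functional j (P 2%N) = (j == 2%N)%:R.
  have -> : P 2%N = 'X * P 1%N - beta 1%N *: P 1%N - gamma1 1%N *: P 0%N.
    by rewrite h2 mulrBl mul_polyC.
  rewrite !linearB !linearZ /= coordX (T_ext E1) E1 E0 /T.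
  by case: j => [|[|[|j]]] /=; ring.
suff: (forall j, coord_functional j (P n) = (j == n)%:R) /\
      (forall j, coord_functional j (P n.+1) = (j == n.+1)%:R) /\
      (forall j, coord_functional j (P n.+2) = (j == n.+2)%:R) by case.
elim: n => // n [In [In1 In2]]; split=> //; split=> // j.
have -> : P n.+3 = 'X * P n.+2 - beta n.+2 *: P n.+2 - gamma1 n.+2 *: P n.+1
                   - gamma0 n.+1 *: P n by rewrite h3; ring.
rewrite !linearB !linearZ /= coordX (T_ext In2) In In1 In2 /T.
have G (g : nat -> C) l m : g l * (l == m)%:R = g m * (l == m)%:R.
  by case: eqP => [->|_] //; rewrite !mulr0.
rewrite !G !eqSS (_ : (if j is i.+1 then _ else 0) = (j == n.+3)%:R) //; last by case: j.
have -> : gamma0 j.+1 * (j == n)%:R = gamma0 n.+1 * (j == n)%:R.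
  by case: eqP => [->|_] //; rewrite !mulr0.
by ring.
Qed.

Let coordXP m : forall n j,
  ((j + 2 * m < n)%N -> coord_functional j ('X^m * P n) = 0) /\
  (coord_functional j ('X^m * P (j + 2 * m)%N) != 0).
Proof.
have [_ _ _ hg _] := rec.
suff [Hz Hn] : (forall n j, (j + 2 * m < n)%N ->
     coord_functional j ('X^m * P n) = 0) /\
     forall j, coord_functional j ('X^m * P (j + 2 * m)%N) != 0.
  by move=> n j; split; [exact: Hz | exact: Hn].
elim: m => [|m [Iz In]].
  split=> [n j | j]; rewrite muln0 addn0 expr0 mul1r coordP ?eqxx ?oner_neq0 //.
  by move=> h; rewrite ltn_eqF.
have S j : (j + 2 * m.+1 = j.+2 + 2 * m)%N by rewrite mulnS addnA addn2.
split=> [n j h | j].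
  rewrite S in h; rewrite exprS -mulrA coordX /T.
  have Iz' i : (i <= j.+2)%N -> coord_functional i ('X^m * P n) = 0.
    by move=> hi; apply: Iz; apply: leq_ltn_trans h; rewrite leq_add2r.
  by case: j Iz' {h} => [|j] Iz'; rewrite !Iz' ?mulr0 ?addr0 // ltnW // ltnW.
rewrite S exprS -mulrA coordX /T.
rewrite (Iz _ j) ?(Iz _ j.+1); try by rewrite ltn_add2r.
rewrite (_ : (if j is i.+1 then _ else 0) = 0); last first.
  by case: j => // j; rewrite Iz // ltn_add2r ltnS ltnW.
by rewrite !mulr0 !addr0 add0r mulf_neq0.
Qed.

(* Favard-type converse: the recurrence alone already provides a monic
   sequence and functionals u1, u2 for which it is 2-orthogonal. *)
Lemma four_term_two_orthogonal :
  monic_sequence P /\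
  exists u1 u2 : {scalar {poly C}}, two_orthogonal u1 u2 P.
Proof.
split; last first.
  exists (coord_functional 0), (coord_functional 1) => m; split=> [n h | | n h |].
  - by apply: (coordXP m n 0).1; rewrite add0n -addn1.
  - exact: (coordXP m 0 0).2.
  - by apply: (coordXP m n 1).1; rewrite add1n -addn2.
  - by rewrite addnC; apply: (coordXP m 0 1).2.
have [h0 h1 h2 _ h3] := rec.
have step (p q : {poly C}) n : p \is monic -> size p = n.+1 -> (size q <= n.+1)%N ->
    'X * p + q \is monic /\ size ('X * p + q)%R = n.+2.
  move=> mp sp sq.
  have sX : size ('X * p)%R = n.+2.
    by rewrite mulrC size_mulX ?sp // monic_neq0.
  split; last by rewrite size_polyDl sX.
  by rewrite monicE lead_coefDl ?sX // lead_coefM lead_coefX mul1r -monicE.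
have sZ c (p : {poly C}) n : (size p <= n)%N -> (size (- (c *: p))%R <= n)%N.
  by move=> h; rewrite size_polyN (leq_trans (size_scale_leq _ _)).
have sD (p q : {poly C}) n : (size p <= n)%N -> (size q <= n)%N ->
    (size (p + q)%R <= n)%N.
  by move=> hp hq; rewrite (leq_trans (size_polyD _ _)) // geq_max hp.
have E0 : P 0%N \is monic /\ size (P 0%N) = 1%N by rewrite h0 monic1 size_poly1.
have E1 : P 1%N \is monic /\ size (P 1%N) = 2%N.
  by rewrite h1 monicXsubC size_XsubC.
have E2 : P 2%N \is monic /\ size (P 2%N) = 3%N.
  have -> : P 2%N = 'X * P 1%N + (- (beta 1%N *: P 1%N) - gamma1 1%N *: P 0%N).
    by rewrite h2 mulrBl mul_polyC addrA.
  by apply: step; rewrite ?E1.1 ?E1.2 // sD // sZ // ?E1.2 ?E0.2.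
move=> n.
suff: [/\ P n \is monic /\ size (P n) = n.+1,
          P n.+1 \is monic /\ size (P n.+1) = n.+2
        & P n.+2 \is monic /\ size (P n.+2) = n.+3] by case.
elim: n => // n [[_ s0] [m1 s1] [m2 s2]]; split=> //.
have -> : P n.+3 = 'X * P n.+2 + (- (beta n.+2 *: P n.+2)
    - gamma1 n.+2 *: P n.+1 - gamma0 n.+1 *: P n) by rewrite h3; ring.
by apply: step => //; rewrite !sD // sZ // ?s0 ?s1 ?s2 // ltnW.
Qed.

End FavardFunctionals.

(* Main.v *)
Require Import Defs.
From mathcomp Require Import all_boot all_order all_algebra.
From mathcomp Require Import reals complex.
From mathcomp Require Import boolp zify ring.

Set Implicit Arguments.
Unset Strict Implicit.
Unset Printing Implicit Defensive.

Import GRing.Theory.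
Local Open Scope ring_scope.
Local Open Scope complex_scope.

(** Applying the four-term recurrence three times writes x^3 P_m as a constant
    combination of P_k with m - 6 <= k <= m + 3.  For m = 3 n + i with i < 3 these
    indices lie in the blocks n - 2, ..., n + 1, which gives the matrix recurrence
    evaluated at x^3 and applied to (1, x, x^2)^T.  A polynomial matrix M is
    determined by M(x^3) (1, x, x^2)^T, since the entries of a row of M are read
    off from exponents in distinct classes modulo 3. *)

(** The coefficients form a total sequence on a half-open range, so that the sum can later be cut at
    multiples of 3. *)
Definition band_span (C : pzRingType) (V : lmodType C) (P : nat -> V)
    (lo hi : nat) (p : V) : Prop :=
  exists a : nat -> C, p = \sum_(lo <= k < hi) a k *: P k.

Section BandSpan.
Variables (C : pzRingType) (V : lmodType C) (P : nat -> V) (lo hi : nat).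

Lemma band_span0 : band_span P lo hi 0.
Proof. by exists (fun=> 0); rewrite big1 // => k _; rewrite scale0r. Qed.

Lemma band_spanD p q :
  band_span P lo hi p -> band_span P lo hi q -> band_span P lo hi (p + q).
Proof.
move=> [a ->] [b ->]; exists (fun k => a k + b k).
by rewrite -big_split; apply: eq_bigr => k _; rewrite scalerDl.
Qed.

Lemma band_spanZ c p : band_span P lo hi p -> band_span P lo hi (c *: p).
Proof.
move=> [a ->]; exists (fun k => c * a k).
by rewrite scaler_sumr; apply: eq_bigr => k _; rewrite scalerA.
Qed.

Lemma band_span_gen k : (lo <= k < hi)%N -> band_span P lo hi (P k).
Proof.
move=> hk; exists (fun j => (j == k)%:R).
rewrite (bigD1_seq k) ?mem_index_iota ?iota_uniq //= eqxx scale1r.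
by rewrite big1 ?addr0 // => j /negPf->; rewrite scale0r.
Qed.

Lemma band_span_sum m n (F : nat -> V) :
  (forall k, (m <= k < n)%N -> band_span P lo hi (F k)) ->
  band_span P lo hi (\sum_(m <= k < n) F k).
Proof.
move=> hF; rewrite big_nat.
by apply: big_ind => //; [exact: band_span0 | exact: band_spanD].
Qed.

End BandSpan.

Section FourTerm.
Variables (C : fieldType) (P : nat -> {poly C}) (beta gamma1 gamma0 : nat -> C).
Hypothesis rec : four_term_recurrence P beta gamma1 gamma0.

(** For k = 0 and k = 1 the initial conditions replace the recurrence; the truncated [k - 2] is then
    0, and no negative index occurs. *)
Lemma band_span_mulX_gen k lo hi :
  (lo <= k - 2)%N -> (k + 2 <= hi)%N -> band_span P lo hi ('X * P k).
Proof.
have [h0 h1 h2 _ h3] := rec; move=> hlo hhi.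
case: k hlo hhi => [|[|k]] hlo hhi.
- have -> : 'X * P 0%N = P 1%N + beta 0%N *: P 0%N.
    by rewrite h1 h0 mulr1 alg_polyC; ring.
  by do !apply: band_spanD; try apply: band_spanZ;
     apply: band_span_gen; lia.
- have -> : 'X * P 1%N = P 2%N + beta 1%N *: P 1%N + gamma1 1%N *: P 0%N.
    by rewrite h2 mulrBl mul_polyC; ring.
  by do !apply: band_spanD; try apply: band_spanZ; apply: band_span_gen; lia.
- rewrite h3.
  by do !apply: band_spanD; try apply: band_spanZ; apply: band_span_gen; lia.
Qed.

Lemma band_span_mulX lo hi p :
  band_span P lo hi p -> band_span P (lo - 2) (hi + 1) ('X * p).
Proof.
move=> [a ->]; rewrite mulr_sumr; apply: band_span_sum => k hk.
by rewrite -scalerAr; apply/band_spanZ/band_span_mulX_gen; lia.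
Qed.

Lemma band_span_mulX3 m : band_span P (m - 6) (m + 4) ('X^3 * P m).
Proof.
have hm : band_span P m m.+1 (P m) by apply: band_span_gen; lia.
have -> : 'X^3 * P m = 'X * ('X * ('X * P m)) by ring.
have -> : (m - 6 = m - 2 - 2 - 2)%N by lia.
have -> : (m + 4 = m.+1 + 1 + 1 + 1)%N by lia.
by do 3!apply: band_span_mulX.
Qed.

End FourTerm.

Definition block_col (V : Type) (P : nat -> V) (n : nat) : 'cV[V]_3 :=
  \col_(i < 3) P (3 * n + i)%N.

Lemma mul_block_col (C : comNzRingType) (P : nat -> {poly C})
    (a : 'I_3 -> nat -> C) n i j :
  (map_mx polyC (\matrix_(i < 3, l < 3) a i (3 * n + l)%N)
     *m block_col P n) i j
  = \sum_(3 * n <= k < 3 * n.+1) a i k *: P k.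
Proof.
(* The added [0 +] gives the lower bound the shape that [big_addn] shifts. *)
rewrite mxE -[RHS]/(\sum_(0 + 3 * n <= k < 3 * n.+1) a i k *: P k) big_addn.
rewrite (_ : (3 * n.+1 - 3 * n = 3)%N); last by lia.
rewrite big_mkord; apply: eq_bigr => l _.
by rewrite !mxE mul_polyC addnC.
Qed.

Lemma block_col_mulX3 (C : fieldType) (P : nat -> {poly C})
    (beta gamma1 gamma0 : nat -> C) n :
  four_term_recurrence P beta gamma1 gamma0 ->
  exists A B D E : 'M[C]_3,
    'X^3 *: block_col P n =
      map_mx polyC A *m zero_ext (block_col P) (n%:Z + 1)
      + map_mx polyC B *m zero_ext (block_col P) n%:Z
      + map_mx polyC D *m zero_ext (block_col P) (n%:Z - 1)
      + map_mx polyC E *m zero_ext (block_col P) (n%:Z - 2).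
Proof.
move=> rec.
(* Since i <= 2, the band of x^3 P_{3n+i} fits between block boundaries that do not depend on i. *)
have widen (i : 'I_3) :
    band_span P (3 * (n - 2)) (3 * n.+2) ('X^3 * P (3 * n + i)%N).
  have [a ->] := band_span_mulX3 rec (3 * n + i).
  apply: band_span_sum => k hk; apply/band_spanZ/band_span_gen.
  by have := ltn_ord i; lia.
have [a ha] := fin_all_exists widen.
pose M m := \matrix_(i < 3, l < 3) a i (3 * m + l)%N.
have row m i j : (map_mx polyC (M m) *m block_col P m) i j
    = \sum_(3 * m <= k < 3 * m.+1) a i k *: P k by exact: mul_block_col.
have addE (X Y : 'cV[{poly C}]_3) i j : (X + Y) i j = X i j + Y i j.
  by rewrite mxE.
(* Each matrix collects the coefficients of one block. For n < 2 the truncated predecessors repeat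
   [M 0], harmlessly: these matrices multiply zero blocks. *)
exists (M n.+1), (M n), (M n.-1), (M n.-2).
have -> : n%:Z + 1 = n.+1 :> int by lia.
apply/matrixP => i j; rewrite mxE [block_col P n i j]mxE ha.
(* The band starts at index 0 when n < 2, so it consists of two blocks for n = 0, three for n = 1,
   and four from n = 2 on. *)
case: n {widen ha} => [|[|n]].
- rewrite /= !mulmx0 !addr0 !addE !row.
  by rewrite (big_cat_nat (n := 3 * 1)) //= addrC.
- rewrite /= !mulmx0 !addr0 !addE !row.
  rewrite (big_cat_nat (n := 3 * 2)) //=.
  by rewrite (big_cat_nat (n := 3 * 1)) //= [X in X + _]addrC addrC addrA.
have -> : n.+2%:Z - 1 = n.+1 :> int by lia.
have -> : n.+2%:Z - 2 = n :> int by lia.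
rewrite /= !addE !row subn2 /=.
rewrite (big_cat_nat (n := 3 * n.+3)) ?leq_mul //=; last by lia.
rewrite (big_cat_nat (n := 3 * n.+2)) ?leq_mul //=; last by lia.
rewrite (big_cat_nat (n := 3 * n.+1)) ?leq_mul //=.
(* The splitting lists blocks by increasing index, the recurrence by decreasing index. *)
by rewrite addrC [X in _ + X]addrC [X in _ + (_ + X)]addrC !addrA.
Qed.

Section CubicDecomposition.
Variable C : fieldType.
Implicit Types M N : 'M[{poly C}]_3.

Let X3 : 'cV[{poly C}]_3 := \col_(i < 3) 'X^i.

Lemma mx_at_cubeD M N : mx_at_cube (M + N) = mx_at_cube M + mx_at_cube N.
Proof. exact: (map_mxD (comp_poly 'X^3)). Qed.

Lemma mx_at_cubeM M N : mx_at_cube (M *m N) = mx_at_cube M *m mx_at_cube N.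
Proof. exact: (map_mxM (comp_poly 'X^3)). Qed.

Lemma mx_at_cubeX M : mx_at_cube ('X *: M) = 'X^3 *: mx_at_cube M.
Proof. by apply/matrixP => i j; rewrite !mxE comp_polyM comp_polyX. Qed.

Lemma mx_at_cubeC (A : 'M[C]_3) :
  mx_at_cube (map_mx polyC A) = map_mx polyC A.
Proof. by apply/matrixP => i j; rewrite !mxE comp_polyC. Qed.

Lemma coef_mx_at_cube M i j k (l : 'I_3) :
  ((mx_at_cube M *m X3) i j)`_(3 * k + l) = (M i l)`_k.
Proof.
rewrite mxE coef_sum (bigD1 l) //= big1 ?addr0 => [|m ml].
  rewrite !mxE coefMXn ltnNge leq_addl addnK /= coef_comp_poly_Xn //.
  by rewrite dvdn_mulr // mulKn.
(* A column m other than l contributes nothing: either 3k + l < m, or 3 does not divide 3k + l - m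
   because 0 < |l - m| < 3. *)
rewrite !mxE coefMXn coef_comp_poly_Xn //.
case: ifP => // /negbT; rewrite -leqNgt => hm.
rewrite ifN //; apply: contraNN ml => hd; rewrite -val_eqE /=.
by have := ltn_ord m; have := ltn_ord l; lia.
Qed.

Lemma mx_at_cube_inj M N : mx_at_cube M *m X3 = mx_at_cube N *m X3 -> M = N.
Proof.
move=> MN; apply/matrixP => i l; apply/polyP => k.
by rewrite -(coef_mx_at_cube M i 0) MN coef_mx_at_cube.
Qed.

Lemma zero_ext_cubic_decomposition (P : nat -> {poly C}) W k :
  cubic_decomposition P W ->
  zero_ext (block_col P) k = mx_at_cube (zero_ext W k) *m X3.
Proof.
move=> PW; case: k => n /=; first exact: PW.
by rewrite (_ : mx_at_cube 0 = 0) ?mul0mx //; exact: (map_mx0 (comp_poly 'X^3)).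
Qed.

End CubicDecomposition.

Theorem theorem5 (R : realType) (P : nat -> {poly R[i]})
    (u1 u2 : {scalar {poly R[i]}}) (beta gamma1 gamma0 : nat -> R[i])
    (W : nat -> 'M[{poly R[i]}]_3) :
  monic_sequence P ->
  two_orthogonal u1 u2 P ->
  four_term_recurrence P beta gamma1 gamma0 ->
  cubic_decomposition P W ->
  exists A B C D : nat -> 'M[R[i]]_3,
    forall n : nat,
      'X *: W n = map_mx polyC (A n) *m zero_ext W (n%:Z + 1)
                  + map_mx polyC (B n) *m zero_ext W n%:Z
                  + map_mx polyC (C n) *m zero_ext W (n%:Z - 1)
                  + map_mx polyC (D n) *m zero_ext W (n%:Z - 2).
Proof.
move=> _ _ rec PW.
have /choice[A /choice[B /choice[C /choice[D H]]]] :=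
  fun n => block_col_mulX3 n rec.
(* Both sides are compared after substituting x^3 and applying (1, x, x^2)^T; the constant matrices
   are unchanged by the substitution. *)
exists A, B, C, D => n; apply: mx_at_cube_inj.
rewrite mx_at_cubeX !mx_at_cubeD !mx_at_cubeM !mx_at_cubeC !mulmxDl -scalemxAl.
by rewrite -!mulmxA -!(zero_ext_cubic_decomposition _ PW) -H.
Qed.
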